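(* Let $\alpha\in[0,1]$. Let $G_1$ be a $t_1$-regular graph of order $n_1$ and size $m_1$, and let $G_2$ be an arbitrary graph of order $n_2$. Then $$\begin{aligned}\phi_{A_{\alpha}(G_1 \underline{\vee}_Q G_2)}(\nu) &=\big(\nu+2-\alpha (2t_1 +n_2 +2)\big)^{m_1 -n_1}\, \phi_{A_{\alpha}(G_2)}(\nu- \alpha m_1)\\ &\quad\times \prod_{i=2}^{n_1}\Big(\nu^2 -\big( \alpha(t_1 +n_2 +2)+t_1 -2 +\lambda_i(A_{\alpha}(G_1))\big)\nu +\alpha^2 t_1 n_2 + \big( \alpha(t_1 +1)-1\big)\big( t_1 +\lambda_i(A_{\alpha}(G_1))\big)\Big)\\ &\quad\times \Big((\nu-\alpha t_1)(\nu-2\alpha t_1 -\alpha n_2) -(1-\alpha)(2t_1 -2)(\nu-\alpha t_1 +1 -\alpha)-2(1-\alpha)^2 -m_1(1-\alpha)^2(\nu-\alpha t_1)\,\Upsilon_{A_{\alpha}(G_2)}(\nu-\alpha m_1) \Big).\end{aligned}$$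
   Context: All graphs are finite, undirected and simple. For a graph $G$ with adjacency matrix $A(G)$ and diagonal degree matrix $D(G)$, put $A_\alpha(G)=\alpha D(G)+(1-\alpha)A(G)$. For an $n\times n$ matrix $M$, $\phi_M(\nu)=\det(\nu I_n-M)$, and for symmetric $M$ the eigenvalues are listed with multiplicity as $\lambda_1(M)\ge\lambda_2(M)\ge\cdots\ge\lambda_n(M)$. The $M$-coronal is the rational function $\Upsilon_M(\nu)=\mathbf 1_n^T(\nu I_n-M)^{-1}\mathbf 1_n$, where $\mathbf 1_n$ is the all-ones column vector. The identity is an identity of rational functions in $\nu$. The $Q$-graph $\mathcal Q(G)$ is obtained from $G$ by inserting a new vertex into each edge of $G$ (so each edge is subdivided: the new vertex is adjacent to the two ends of the edge, and the original edge is no longer present), and then making two new vertices adjacent whenever they lie on adjacent edges of $G$ (distinct edges sharing an endpoint). The $Q$-edge join $G_1\underline\vee_Q G_2$ is obtained from the disjoint union of $\mathcal Q(G_1)$ and $G_2$ by joining each newly inserted vertex of $\mathcal Q(G_1)$ to every vertex of $G_2$. *)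

(* Defs.v *)
From HB Require Import structures.
From mathcomp Require Import all_boot all_order all_algebra.
From mathcomp Require Import polyrcf.

Set Implicit Arguments.
Unset Strict Implicit.
Unset Printing Implicit Defensive.

Import Order.TTheory GRing.Theory Num.Theory.

Local Open Scope ring_scope.

Record sgraph := SGraph {
  vertex :> finType;
  adj : rel vertex;
  adj_sym : symmetric adj;
  adj_irr : irreflexive adj }.

Definition degree (G : sgraph) (x : G) : nat := #|[set y | adj x y]|.

Definition regular (t : nat) (G : sgraph) : Prop :=
  forall x : G, degree x = t.

Definition edges (G : sgraph) : {set {set G}} :=
  [set e | [exists x, exists y, adj x y && (e == [set x; y])]].

Definition edge (G : sgraph) : finType := {e : {set G} | e \in edges G}.

Section QGraph.
Variable G : sgraph.

(* [inl x] is an old vertex, [inr e] the vertex inserted into the edge [e] *)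
Definition Qadj (u v : G + edge G) : bool :=
  match u, v with
  | inl _, inl _ => false
  | inl x, inr e | inr e, inl x => x \in val e
  | inr e, inr f => (e != f) && (val e :&: val f != set0)
  end.

Fact Qadj_sym : symmetric Qadj.
Proof. by case=> [x|e] [y|f] //=; rewrite eq_sym setIC. Qed.

Fact Qadj_irr : irreflexive Qadj.
Proof. by case=> [x|e] //=; rewrite eqxx. Qed.

Definition Qgraph : sgraph := SGraph Qadj_sym Qadj_irr.

Definition inserted (u : Qgraph) : bool :=
  match u with inl _ => false | inr _ => true end.

End QGraph.

Section QEdgeJoin.
Variables G1 G2 : sgraph.

Definition Qjoin_adj (u v : Qgraph G1 + G2) : bool :=
  match u, v with
  | inl x, inl y => adj x y
  | inr x, inr y => adj x y
  | inl x, inr _ | inr _, inl x => inserted x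
  end.

Fact Qjoin_adj_sym : symmetric Qjoin_adj.
Proof. by case=> [u|x] [v|y]; [exact: adj_sym|..|exact: adj_sym]. Qed.

Fact Qjoin_adj_irr : irreflexive Qjoin_adj.
Proof. by case=> [u|x]; exact: adj_irr. Qed.

Definition Qjoin : sgraph := SGraph Qjoin_adj_sym Qjoin_adj_irr.

End QEdgeJoin.

Section GraphMatrices.
Variables (R : pzRingType) (G : sgraph).

(* Rows and columns follow the enumeration [enum_val] of the vertices. *)
Definition adj_mx : 'M[R]_#|G| :=
  \matrix_(i, j) (adj (enum_val i) (enum_val j))%:R.

Definition deg_mx : 'M[R]_#|G| :=
  diag_mx (\row_i (degree (enum_val i))%:R).

Definition A_mx (alpha : R) : 'M[R]_#|G| :=
  alpha *: deg_mx + (1 - alpha) *: adj_mx.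

End GraphMatrices.

Arguments adj_mx R G : clear implicits.
Arguments deg_mx R G : clear implicits.
Arguments A_mx {R} G alpha.

(* The roots in [R] of the characteristic polynomial, repeated according to
   multiplicity, in nonincreasing order; a symmetric [M] has all [n] of them. *)
Definition eigenvalues (R : rcfType) n (M : 'M[R]_n) : seq R :=
  sort (fun x y => y <= x)
    (flatten [seq nseq (mup x (char_poly M)) x | x <- rootsR (char_poly M)]).

(* Indices start at 1, so [lambda 1 M] is the largest eigenvalue. *)
Definition lambda (R : rcfType) n (i : nat) (M : 'M[R]_n) : R :=
  nth 0 (eigenvalues M) i.-1.

Notation ratfun R := {fraction {poly R}}.
Notation "p %:F" := (tofrac p) : ring_scope.

(* The coronal of [M], with the rational function [x] substituted for its
   indeterminate: [coronal M 'X%:F] is the coronal itself.  The inverse is the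
   true one whenever [det (x - M)] is nonzero, in particular for nonconstant
   [x]. *)
Definition coronal (R : fieldType) n (M : 'M[R]_n) (x : ratfun R) : ratfun R :=
  let ones : 'cV[ratfun R]_n := const_mx 1 in
  (ones^T *m invmx (x%:M - map_mx (fun a : R => (a%:P)%:F) M) *m ones) 0 0.

(* Main.v *)
Require Import Defs.
From mathcomp Require Import all_boot all_order all_algebra.
From mathcomp Require Import perm polyrcf complex ring.
Import Order.TTheory GRing.Theory Num.Theory.
Local Open Scope ring_scope.
Set Implicit Arguments.
Unset Strict Implicit.
Unset Printing Implicit Defensive.

(* Order the vertices as old vertices of G1, inserted vertices, vertices of G2,
   and let B be the incidence matrix of G1.  Then B^T B - 2 is the adjacency
   matrix of the line graph, B B^T = t1 + A(G1), and nu - A_alpha of the join has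
   diagonal blocks a I, c I - b B^T B and N = nu - alpha m1 - A_alpha(G2), with
   a = nu - alpha t1, b = 1 - alpha and c = nu + 2 - alpha (2 t1 + n2 + 2).
   Eliminating N and a I by Schur complements leaves c I - B^T (k I + s J) B
   with scalars k and s, because the all-ones matrices satisfy 4 J = B^T J B.  Sylvester's identity
   moves this to size n1 at the cost of c^(m1 - n1); there J is a rank one
   perturbation along the eigenvector 1 of A(G1), which only changes the factor
   of the eigenvalue lambda_1 = t1, the others giving the quadratics. *)

(** * Determinants *)

Lemma horner_char_poly (R : comNzRingType) n (M : 'M[R]_n) (u : R) :
  (char_poly M).[u] = \det (u%:M - M).
Proof.
rewrite -/(horner_eval u (char_poly M)) -det_map_mx; congr (\det _).
apply/matrixP => i j; rewrite !mxE /horner_eval /=.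
by rewrite /horner_eval hornerD hornerN hornerMn hornerX hornerC.
Qed.

Lemma char_poly_comp (R : comNzRingType) n (M : 'M[R]_n) (q : {poly R}) :
  char_poly M \Po q = \det (q%:M - map_mx polyC M).
Proof. by rewrite /comp_poly map_char_poly horner_char_poly. Qed.

(** Pulling out [v] leaves the characteristic polynomial evaluated at [u / v]. *)
Lemma det_scalar_sub (K : fieldType) n (M : 'M[K]_n) (s : seq K) (u v : K) :
    char_poly M = \prod_(x <- s) ('X - x%:P) -> v != 0 ->
  \det (u%:M - v *: M) = \prod_(x <- s) (u - v * x).
Proof.
move=> hM v0.
have sz : size s = n.
  by apply: succn_inj; rewrite -(size_char_poly M) hM size_prod_XsubC.
have -> : u%:M - v *: M = v *: ((u / v)%:M - M).
  by rewrite scalerBr -[in RHS]scalemx1 scalerA mulrC divfK // scalemx1.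
rewrite detZ -horner_char_poly hM horner_prod -sz.
have -> : v ^+ size s = \prod_(x <- s) v.
  by rewrite big_const_seq count_predT -Monoid.iteropE.
by rewrite -big_split; apply: eq_bigr => x _ /=; rewrite hornerXsubC; field.
Qed.

Lemma det_block_schur_dr (K : fieldType) n p (A : 'M[K]_n) (B : 'M_(n, p))
    (C : 'M_(p, n)) (D : 'M_p) :
  D \in unitmx ->
  \det (block_mx A B C D) = \det D * \det (A - B *m invmx D *m C).
Proof.
move=> uD.
have -> : block_mx A B C D =
    block_mx 1%:M (B *m invmx D) 0 1%:M *m block_mx (A - B *m invmx D *m C) 0 C D.
  rewrite mulmx_block !mul1mx !mul0mx !add0r subrK.
  by rewrite -mulmxA mulVmx // mulmx1.
by rewrite det_mulmx det_ublock det_lblock !det1 !mul1r mulrC.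
Qed.

Lemma det_block_schur_scalar (K : fieldType) n p (a : K) (B : 'M_(n, p))
    (C : 'M_(p, n)) (D : 'M_p) :
  a != 0 ->
  \det (block_mx a%:M B C D) = a ^+ n * \det (D - a^-1 *: (C *m B)).
Proof.
move=> a0.
have -> : block_mx a%:M B C D =
    block_mx 1%:M 0 (a^-1 *: C) 1%:M *m block_mx a%:M B 0 (D - a^-1 *: (C *m B)).
  rewrite mulmx_block !mul1mx !mul0mx !addr0 mul_mx_scalar scalerA.
  by rewrite mulfV // scale1r -scalemxAl addrC subrK.
by rewrite det_mulmx det_ublock det_lblock !det1 !mul1r det_scalar.
Qed.

(** Both sides are the determinant of one block matrix, with diagonal blocks [c] and off-diagonal
    blocks [c *: Y] and [X], evaluated by the Schur complement of either diagonal block. *)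
Lemma det_sylvester (K : fieldType) n m (c : K) (X : 'M_(m, n)) (Y : 'M_(n, m)) :
  c != 0 ->
  c ^+ n * \det (c%:M - X *m Y) = c ^+ m * \det (c%:M - Y *m X).
Proof.
move=> c0.
have := @det_block_schur_scalar _ n m c (c *: Y) X c%:M c0.
rewrite -scalemxAr scalerA mulVf // scale1r => <-.
rewrite det_block_schur_dr; last by rewrite unitmxE det_scalar unitfE expf_neq0.
rewrite det_scalar; congr (_ * \det (_ - _)).
by rewrite invmx_scalar mul_mx_scalar scalerA mulVf // scale1r.
Qed.

(** Since the ones row is a left eigenvector of [P], [const_mx w] equals (w / q) J P. So [P] factors
    out, and Sylvester's identity with inner size 1 evaluates the other factor. *)
Lemma det_sub_const (K : fieldType) n (P : 'M[K]_n) (q w : K) :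
    const_mx 1 *m P = q *: (const_mx 1 : 'rV_n) -> q != 0 ->
  \det (P - const_mx w) * q = \det P * (q - n%:R * w).
Proof.
move=> hP q0; pose o : 'rV[K]_n := const_mx 1.
have -> : P - const_mx w = (1%:M - (w / q) *: (o^T *m o)) *m P.
  rewrite mulmxBl mul1mx -scalemxAl -mulmxA hP -scalemxAr scalerA divfK //.
  by congr (_ - _); apply/matrixP=> i j; rewrite !mxE big_ord1 !mxE !mulr1.
rewrite det_mulmx mulrAC mulrC; congr (_ * _).
have := @det_sylvester _ 1 n 1 ((w / q) *: o^T) o (oner_neq0 _).
rewrite !expr1n !mul1r -scalemxAl -scalemxAr => ->.
rewrite det_mx11 !mxE (eq_bigr (fun=> 1)); last by move=> i _; rewrite !mxE mul1r.
by rewrite sumr_const card_ord mulr1n -[1 *+ n]/(n%:R); field.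
Qed.

(* The incidence matrix [B] of a [t]-regular graph enters only through the row
   and column sums [t] and [2]. *)
Lemma det_join_block (K : fieldType) n m p (B : 'M[K]_(n, m)) (N : 'M[K]_p)
    (a b c t : K) :
  let g := a * c in let h := b * (a + b) in let q := g - h * (2 * t) in
  let ones k : 'rV[K]_k := const_mx 1 in
    2 != 0 :> K -> a != 0 -> c != 0 -> q != 0 -> N \in unitmx ->
    ones n *m B = 2 *: ones m -> B *m (ones m)^T = t *: (ones n)^T ->
  \det (block_mx
     (block_mx a%:M (- b *: B) (- b *: B^T) (c%:M - b *: (B^T *m B)))
     (col_mx 0 (const_mx (- b))) (row_mx 0 (const_mx (- b))) N) * (c ^+ n * q) =
  \det N * c ^+ m * \det (g%:M - h *: (B *m B^T)) *
   (q - m%:R * b ^+ 2 * a * (ones p *m invmx N *m (ones p)^T) 0 0).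
Proof.
move=> g h q ones nz2 a0 c0 q0 uN h2 ht.
pose G := (ones p *m invmx N *m (ones p)^T) 0 0.
have hG : ones p *m invmx N *m (ones p)^T = G%:M by rewrite [LHS]mx11_scalar.
have constE k l (x : K) : const_mx x = x *: ((ones k)^T *m ones l).
  by apply/matrixP=> i j; rewrite !mxE big_ord1 !mxE !mulr1.
rewrite det_block_schur_dr //.
(* Only inserted vertices meet the last block, so a single corner changes, and [invmx N] survives
   there only through the scalar [G], the value of the coronal. *)
have -> : col_mx 0 (const_mx (- b)) *m invmx N *m row_mx 0 (const_mx (- b)) =
    block_mx (0 : 'M_n) 0 0 ((b ^+ 2 * G) *: ((ones m)^T *m ones m)).
  rewrite mul_col_mx mul0mx mul_col_row !mul0mx !mulmx0; congr block_mx.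
  rewrite (constE m p) (constE p m) -!scalemxAl -scalemxAr scalerA mulrNN.
  rewrite -!mulmxA (mulmxA (invmx N)) (mulmxA (ones p)) (mulmxA (ones p)) hG.
  by rewrite mul_scalar_mx -scalemxAr scalerA.
rewrite opp_block_mx add_block_mx !oppr0 !addr0 det_block_schur_scalar //.
have onesm : ones m = 2^-1 *: (ones n *m B).
  by rewrite h2 scalerA mulVf // scale1r.
(* [k] gathers the B^T B terms of the line graph block and of the elimination of [a]; the 4 in [s]
   comes from the two factors 1/2 of [onesm]. *)
pose s := b ^+ 2 * G / 4; pose k := b + a^-1 * b ^+ 2.
have nz4 : 4 != 0 :> K by rewrite -[4]/((2 * 2)%:R) natrM mulf_neq0.
have hC : c%:M - b *: (B^T *m B) - b ^+ 2 * G *: ((ones m)^T *m ones m) -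
    a^-1 *: ((- b *: B^T) *m (- b *: B)) =
    c%:M - B^T *m ((k%:M + s *: ((ones n)^T *m ones n)) *m B).
  rewrite onesm [(_ *: _)^T]linearZ /= trmx_mul -!scalemxAl -!scalemxAr !scalerA.
  rewrite mulmxDl mulmxDr mul_scalar_mx -!scalemxAl -!scalemxAr !mulmxA.
  have -> : k = b + a^-1 * - b * - b by rewrite /k; field.
  have -> : s = b ^+ 2 * G / 2 / 2 by rewrite /s; field; rewrite nz4 nz2.
  by rewrite [(b + _) *: _]scalerDl !opprD !addrA [LHS]addrAC.
rewrite hC.
have hS := @det_sylvester _ n m c B^T ((k%:M + s *: ((ones n)^T *m ones n)) *m B) c0.
pose P := g%:M - h *: (B *m B^T).
have hH : ones n *m (B *m B^T) = (2 * t) *: ones n.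
  rewrite mulmxA h2 -scalemxAl -[ones m *m _]trmxK trmx_mul trmxK ht linearZ /=.
  by rewrite trmxK scalerA.
have hP : ones n *m P = q *: ones n.
  by rewrite mulmxBr mul_mx_scalar -scalemxAr hH scalerA -scalerBl.
(* Multiplying by [a] clears denominators, as a c = g and a k = h; the remaining term is constant
   because J B B^T = 2 t J. *)
have hY : a ^+ n * \det (c%:M - (k%:M + s *: ((ones n)^T *m ones n)) *m B *m B^T)
   = \det (P - const_mx (a * s * (2 * t))).
  rewrite -detZ; congr (\det _); rewrite scalerBr scale_scalar_mx /P -addrA.
  congr (_ + _); rewrite -mulmxA mulmxDl mul_scalar_mx scalerDr opprD scalerA.
  congr (_ - _).
    by rewrite /h /k; congr (- (_ *: _)); field.
  rewrite (constE n n) -scalemxAl -mulmxA hH -scalemxAr !scalerA.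
  by congr (_ *: _); rewrite mulrA.
(* Summing the entries of [B] by rows and by columns gives n t = 2 m; the doubled form cancels the 4
   in [s]. *)
have hm : n%:R * (2 * t) = 4 * m%:R.
  have sumo l : ones l *m (ones l)^T = (l%:R)%:M.
    rewrite [LHS]mx11_scalar mxE (eq_bigr (fun=> 1)) ?sumr_const ?card_ord //.
    by move=> i _; rewrite !mxE mulr1.
  have : ones n *m B *m (ones m)^T = 2 *: (ones m *m (ones m)^T).
    by rewrite h2 -scalemxAl.
  rewrite -mulmxA ht -scalemxAr !sumo !scale_scalar_mx.
  move/(congr1 (fun M : 'M_1 => M 0 0)); rewrite !mxE !mulr1n => e.
  have -> : n%:R * (2 * t) = 2 * (t * n%:R) by ring.
  by rewrite e; ring.
have hdet := det_sub_const (a * s * (2 * t)) hP q0.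
have -> : \det N * (a ^+ n *
   \det (c%:M - B^T *m ((k%:M + s *: ((ones n)^T *m ones n)) *m B))) * (c ^+ n * q) =
   \det N * (a ^+ n * (c ^+ n *
   \det (c%:M - B^T *m ((k%:M + s *: ((ones n)^T *m ones n)) *m B)))) * q by ring.
rewrite hS [a ^+ n * _]mulrCA hY.
rewrite -[LHS]mulrA -[_ * _ * q]mulrA hdet [LHS]mulrA [_ * (\det P * _)]mulrA.
congr (_ * (q - _)); have -> : n%:R * (a * s * (2 * t)) = a * s * (n%:R * (2 * t)).
  by ring.
by rewrite hm /s -/G; field.
Qed.

(** * Eigenvalues of symmetric matrices *)

(** With [w] the conjugate transpose of [v], computing v M w in two ways shows that [z] and its
    conjugate agree after multiplication by N = v w, the sum of the |v_i|^2, which is nonzero. *)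
Lemma eigenvalue_real (C : numClosedFieldType) n (M : 'M[C]_n) (z : C) :
  map_mx Num.conj M^T = M -> eigenvalue M z -> z \is Num.real.
Proof.
move=> hM /eigenvalueP[v hv v0]; apply/CrealP.
pose w := map_mx Num.conj v^T; pose N : C := (v *m w) 0 0.
have conj_trmx k l p (X : 'M[C]_(k, l)) (Y : 'M_(l, p)) :
    map_mx Num.conj (X *m Y)^T = map_mx Num.conj Y^T *m map_mx Num.conj X^T.
  by rewrite trmx_mul map_mxM.
have hw : map_mx Num.conj w^T = v by apply/matrixP=> i j; rewrite !mxE conjCK.
have hN : N != 0.
  apply: contraNneq v0 => N0; apply/eqP/rowP => i; rewrite mxE.
  have : \sum_i `|v 0 i| ^+ 2 == 0.
    rewrite -[X in _ == X]N0 /N mxE.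
    by apply/eqP; apply: eq_bigr => j _; rewrite !mxE normCK.
  rewrite psumr_eq0 => [/allP/(_ i (mem_index_enum i))|j _]; last first.
    by rewrite exprn_ge0.
  by rewrite /= sqrf_eq0 normr_eq0 => /eqP.
have e1 : v *m M *m w = z *: (v *m w) by rewrite hv scalemxAl.
have e2 : v *m M *m w = z^* *: (v *m w).
  rewrite -{1}hw -[X in _ *m X *m _]hM -[LHS]mulmxA -conj_trmx -conj_trmx.
  by rewrite hv -scalemxAl linearZ /= map_mxZ conj_trmx hw.
suff : z^* * N = z * N by move/(mulIf hN).
move: (congr1 (fun X : 'M_1 => X 0 0) e1).
by rewrite e2 [LHS]mxE [RHS]mxE.
Qed.

(** Over [R[i]] the polynomial splits with real roots, by [eigenvalue_real]; their real parts give
    the factorization over [R]. *)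
Lemma char_poly_sym_split (R : rcfType) n (M : 'M[R]_n) :
  M^T = M -> exists s : seq R, char_poly M = \prod_(x <- s) ('X - x%:P).
Proof.
move=> hM; pose f : {rmorphism R -> R[i]} := real_complex R.
have [r] := closed_field_poly_normal (char_poly (map_mx f M)).
rewrite (monicP (char_poly_monic _)) scale1r => hr.
exists (map (@complex.Re R) r); apply: (map_poly_inj f).
rewrite map_char_poly hr rmorph_prod big_map; apply: eq_big_seq => z zr.
rewrite /= rmorphB /= map_polyX map_polyC /= RRe_real //.
apply: (@eigenvalue_real _ _ (map_mx f M)).
  by apply/matrixP=> i j; rewrite -{2}hM !mxE; apply: conjc_real.
by rewrite eigenvalue_root_char hr root_prod_XsubC.
Qed.

(** [eigenvalues] repeats each root according to its [mup], which is its number of occurrences in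
    [s]. *)
Lemma perm_eigenvalues (R : rcfType) n (M : 'M[R]_n) (s : seq R) :
  char_poly M = \prod_(x <- s) ('X - x%:P) -> perm_eq (eigenvalues M) s.
Proof.
move=> hM; rewrite /eigenvalues perm_sort hM; set p := (X in rootsR X).
have p0 : p != 0 by rewrite monic_neq0 // monic_prod_XsubC.
apply/allP => x _ /=; apply/eqP.
have mem_r y : (y \in rootsR p) = (y \in s).
  by rewrite -roots_on_rootsR // in_itv /= root_prod_XsubC.
rewrite count_flatten -map_comp sumnE big_map.
rewrite (eq_bigr (fun y => if y == x then count_mem x s else 0%N)); last first.
  move=> y _ /=; rewrite count_nseq mu_prod_XsubC /= eq_sym.
  by case: eqVneq => [->|]; rewrite ?mul1n ?mul0n.
have [xs|xNs] := boolP (x \in s); last first.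
  rewrite (count_memPn xNs) big1_seq // => y _; by rewrite if_same.
rewrite (bigD1_seq x) ?mem_r ?uniq_roots //= eqxx big1 ?addn0 // => y.
by move/negPf->.
Qed.

Lemma eigenvalues_sorted (R : rcfType) n (M : 'M[R]_n) :
  sorted (fun x y => y <= x) (eigenvalues M).
Proof. by apply: sort_sorted => x y; rewrite le_total. Qed.

Lemma lambda1E (R : rcfType) n (M : 'M[R]_n) (t : R) :
  t \in eigenvalues M -> (forall x, x \in eigenvalues M -> x <= t) ->
  lambda 1 M = t.
Proof.
rewrite /lambda; have := eigenvalues_sorted M; case: (eigenvalues M) => //= x l.
rewrite (path_sortedE (fun a b c h1 h2 => le_trans h2 h1)) => /andP[/allP hx _].
rewrite inE => /predU1P[-> //|/hx tx] /(_ _ (mem_head _ _)) xt.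
by apply/eqP; rewrite eq_le tx xt.
Qed.

Lemma prod_lambda (R : rcfType) (K : comNzRingType) n (M : 'M[R]_n) (F : R -> K) :
  \prod_(x <- eigenvalues M) F x =
  \prod_(1 <= i < (size (eigenvalues M)).+1) F (lambda i M).
Proof. by rewrite (big_nth 0) big_add1. Qed.

(** * Incidence matrices and the matrix of the join *)

(** Once the two sizes are identified, [f] permutes rows and columns alike, so its sign occurs twice
    and cancels. *)
Lemma det_mxsub_bij (R : comPzRingType) n m (f : 'I_n -> 'I_m) (A : 'M[R]_m) :
  bijective f -> \det (mxsub f f A) = \det A.
Proof.
move=> bf; have enm : n = m by have := bij_eq_card bf; rewrite !card_ord.
case: m / enm f A bf => f A /bij_inj injf; pose s := perm injf.
have -> : mxsub f f A = row_perm s (col_perm s A).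
  by apply/matrixP => i j; rewrite !mxE !permE.
rewrite row_permE col_permE !det_mulmx !det_perm.
by rewrite odd_permV mulrCA -signr_addb addbb expr0 mulr1.
Qed.

Lemma char_poly_mx_mxsub_bij (R : nzRingType) n m (f : 'I_n -> 'I_m) (A : 'M[R]_m) :
  bijective f -> char_poly_mx (mxsub f f A) = mxsub f f (char_poly_mx A).
Proof.
by move=> /bij_inj injf; apply/matrixP => i j; rewrite !mxE (inj_eq injf).
Qed.

Section Incidence.
Variable G : sgraph.
Implicit Types (x y : G) (e f : edge G).

Lemma edge_at e x : x \in val e -> exists2 y, adj x y & val e = [set x; y].
Proof.
have := valP e; rewrite inE => /existsP[u /existsP[v /andP[uv /eqP->]]].
rewrite !inE => /orP[] /eqP->; first by exists v.
by exists u; [rewrite adj_sym | rewrite setUC].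
Qed.

Lemma card_edge e : #|val e| = 2%N.
Proof.
have := valP e; rewrite inE => /existsP[u /existsP[v /andP[uv /eqP->]]].
by rewrite cards2; case: eqVneq uv => // ->; rewrite adj_irr.
Qed.

Lemma degreeE x : degree x = (\sum_y adj x y)%N.
Proof.
by rewrite /degree -sum1dep_card big_mkcond; apply: eq_bigr => y _; case: adj.
Qed.

Lemma sum_mem_edge e : (\sum_x (x \in val e) = 2)%N.
Proof.
rewrite -(card_edge e) -sum1_card [RHS]big_mkcond.
by apply: eq_bigr => x _; case: in_mem.
Qed.

(** Off-diagonal entries of B B^T: the only edge that can contain both vertices is [[set x; y]]. *)
Lemma edges_through2 x y :
  x != y -> (\sum_(e : edge G) (x \in val e) * (y \in val e) = adj x y)%N.
Proof.
move=> xy; have [axy|naxy] := boolP (adj x y); last first.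
  rewrite big1 // => e _; case: (boolP (x \in _)) => // /edge_at[z xz ->].
  rewrite !inE eq_sym (negPf xy) /=; case: eqVneq => // yz.
  by move: naxy; rewrite yz xz.
have e0P : [set x; y] \in edges G.
  by rewrite inE; apply/existsP; exists x; apply/existsP; exists y; rewrite axy /=.
pose e0 : edge G := Sub [set x; y] e0P.
rewrite (bigD1 e0) //= !inE !eqxx orbT big1 // => e.
apply: contraNeq; rewrite muln_eq0 !eqb0 negb_or !negbK => /andP[/edge_at[z _ he]].
rewrite he !inE eq_sym (negPf xy) /= => /eqP yz.
by apply/eqP/val_inj; rewrite he -yz.
Qed.

(** Summing [edges_through2] over the vertices [y] other than [x] counts each edge at [x] once, by
    its other end. *)
Lemma edges_through x : (\sum_(e : edge G) (x \in val e) = degree x)%N.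
Proof.
rewrite degreeE (bigD1 x) //= adj_irr add0n.
rewrite (eq_bigr (fun y => \sum_(e : edge G) (x \in val e) * (y \in val e))%N);
  last first.
  by move=> y yx; rewrite edges_through2 // eq_sym.
rewrite exchange_big; apply: eq_bigr => e _ /=.
rewrite -big_distrr /=; have := sum_mem_edge e; rewrite (bigD1 x) //=.
case: (x \in _); last by rewrite mul0n.
by rewrite mul1n add1n => -[->].
Qed.

(** Entries of B^T B: distinct edges share at most one vertex, so off the diagonal the sum is a
    truth value. *)
Lemma sum_edgeI e f :
  (\sum_x (x \in val e) * (x \in val f) =
     if e == f then 2 else (val e :&: val f != set0))%N.
Proof.
have [->|ef] := eqVneq e f.
  by rewrite -(sum_mem_edge f); apply: eq_bigr => x _; case: in_mem.
have -> : (\sum_x (x \in val e) * (x \in val f) = #|val e :&: val f|)%N.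
  rewrite -sum1_card [RHS]big_mkcond; apply: eq_bigr => x _; rewrite inE.
  by do 2![case: (x \in _)].
rewrite -card_gt0; suff : (#|val e :&: val f| < 2)%N by case: #|_| => [|[]].
rewrite ltnNge; apply: contra ef => le2.
(* Two common vertices would exhaust both edges and make them equal. *)
have heq (g : edge G) : val e :&: val f \subset val g -> val e :&: val f = val g.
  by move=> sub; apply/eqP; rewrite eqEcard sub card_edge.
by rewrite -val_eqE -(heq e) ?subsetIl // {1}(heq f) ?subsetIr.
Qed.

Definition inc_mx (R : pzRingType) : 'M[R]_(#|G|, #|edge G|) :=
  \matrix_(i, j) ((enum_val i : G) \in val (enum_val j : edge G))%:R.

Variable R : comNzRingType.

Lemma sum_enum_val (T : finType) (F : T -> nat) :
  \sum_(i < #|T|) (F (enum_val i))%:R = (\sum_x F x)%:R :> R.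
Proof. by rewrite natr_sum [RHS](big_enum_val (A := T)). Qed.

Lemma ones_inc_mx : const_mx 1 *m inc_mx R = 2 *: (const_mx 1 : 'rV_#|edge G|).
Proof.
apply/rowP => j; rewrite !mxE mulr1 -(sum_mem_edge (enum_val j)) -sum_enum_val.
by apply: eq_bigr => i _; rewrite !mxE mul1r.
Qed.

Variables (t : nat) (regG : regular t G).

Lemma inc_mx_ones :
  inc_mx R *m (const_mx 1)^T = t%:R *: (const_mx 1 : 'rV_#|G|)^T.
Proof.
apply/colP => i; rewrite !mxE mulr1 -(regG (enum_val i)) -edges_through -sum_enum_val.
by apply: eq_bigr => j _; rewrite !mxE mulr1.
Qed.

Lemma inc_mx_mul_tr : inc_mx R *m (inc_mx R)^T = t%:R%:M + adj_mx R G.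
Proof.
apply/matrixP => i j; rewrite !mxE; set x := enum_val i; set y := enum_val j.
rewrite (eq_bigr (fun k : 'I_#|edge G| => ((x \in val (enum_val k)) *
   (y \in val (enum_val k)))%N%:R)); last by move=> k _; rewrite !mxE natrM.
rewrite (sum_enum_val (fun e : edge G => (x \in val e) * (y \in val e))%N).
have [ij|ij] := eqVneq i j.
  rewrite /y -ij adj_irr addr0 -(regG x) -edges_through mulr1n; congr (_%:R).
  by apply: eq_bigr => e _; rewrite -/x; case: in_mem.
by rewrite mulr0n add0r edges_through2 // (inj_eq enum_val_inj).
Qed.

(** Row sum of B^T B at [e]: its two ends lie on [t] edges each, and [e] itself accounts for 2.
    Adding 2 on the left avoids truncated subtraction. *)
Lemma sum_Qadj_edge e :
  (\sum_(f : edge G) ((e != f) && (val e :&: val f != set0)) + 2 = 2 * t)%N.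
Proof.
have : (\sum_(f : edge G) \sum_x (x \in val e) * (x \in val f) = 2 * t)%N.
  rewrite exchange_big /= -(sum_mem_edge e) big_distrl.
  by apply: eq_bigr => x _ /=; rewrite -big_distrr /= edges_through regG.
rewrite (bigD1 e) //= sum_edgeI eqxx addnC => <-; congr (_ + _)%N.
rewrite (bigD1 e) //= eqxx; apply: eq_bigr => f fe.
by rewrite sum_edgeI eq_sym (negPf fe).
Qed.

Lemma inc_mx_tr_mul :
  (inc_mx R)^T *m inc_mx R =
  2%:M + \matrix_(i, j) (((enum_val i : edge G) != enum_val j) &&
            (val (enum_val i : edge G) :&: val (enum_val j : edge G) != set0))%:R.
Proof.
apply/matrixP => i j; rewrite !mxE; set e := enum_val i; set f := enum_val j.
rewrite (eq_bigr (fun k : 'I_#|G| => ((enum_val k \in val e) *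
   (enum_val k \in val f))%N%:R)); last by move=> k _; rewrite !mxE natrM.
rewrite (sum_enum_val (fun x : G => (x \in val e) * (x \in val f))%N) sum_edgeI.
rewrite /e /f (inj_eq enum_val_inj).
by case: eqVneq => _ /=; rewrite ?mulr1n ?mulr0n ?addr0 ?add0r.
Qed.

End Incidence.

Section QJoinMatrix.
Variables G1 G2 : sgraph.

(** The index order in which the matrix of the join is a block matrix; the enumeration of the join
    that [A_mx] follows is not assumed to agree with it. *)
Definition Qjoin_ord (i : 'I_(#|G1| + #|edge G1| + #|G2|)) : Qjoin G1 G2 :=
  match split i with
  | inl j => inl match split j with
                 | inl k => inl (enum_val k)
                 | inr k => inr (enum_val k)
                 end
  | inr k => inr (enum_val k)
  end.

Lemma Qjoin_ord_bij : bijective Qjoin_ord.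
Proof.
exists (fun u => unsplit match u with
  | inl v => inl (unsplit match v with
                          | inl x => inl (enum_rank x)
                          | inr e => inr (enum_rank e)
                          end)
  | inr y => inr (enum_rank y)
  end) => [i|].
  rewrite -[RHS]splitK /Qjoin_ord; congr unsplit.
  case: split => [j|k]; rewrite ?enum_valK //; congr inl.
  by rewrite -[RHS]splitK; case: split => k; rewrite enum_valK.
by case=> [[x|e]|y]; rewrite /Qjoin_ord !unsplitK ?enum_rankK.
Qed.

Lemma degree_Qjoin_vertex x :
  degree (inl (inl x) : Qjoin G1 G2) = degree x.
Proof.
rewrite degreeE !big_sumType /= -edges_through.
by rewrite [X in (X + _ + _)%N]big1 // [X in (_ + X)%N]big1 // addn0.
Qed.

(** The neighbours are the two ends, the 2 t - 2 adjacent edges and all of [G2]. *)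
Lemma degree_Qjoin_edge t e :
  regular t G1 -> degree (inl (inr e) : Qjoin G1 G2) = (2 * t + #|G2|)%N.
Proof.
move=> regG; rewrite degreeE !big_sumType /= sum1_card -(sum_Qadj_edge regG e).
by rewrite sum_mem_edge [(2 + _)%N]addnC.
Qed.

Lemma degree_Qjoin_right y :
  degree (inr y : Qjoin G1 G2) = (#|edge G1| + degree y)%N.
Proof. by rewrite !degreeE !big_sumType /= big1 // sum1_card. Qed.

Variables (R : comNzRingType) (alpha : R) (t : nat).

Lemma A_mxE (G : sgraph) i j :
  A_mx G alpha i j = (alpha * (degree (enum_val i))%:R) *+ (i == j) +
    (1 - alpha) * (adj (enum_val i) (enum_val j))%:R.
Proof. by rewrite !mxE -[RHS]addrC -mulrnAr addrC. Qed.

(** Among inserted vertices the adjacency matrix is B^T B - 2 and the degree is 2 t + n2, whence the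
    scalar alpha (2 t + n2) - 2 (1 - alpha) beside (1 - alpha) B^T B. *)
Lemma char_poly_A_Qjoin :
    regular t G1 ->
  char_poly (A_mx (Qjoin G1 G2) alpha) =
  char_poly (block_mx
    (block_mx (alpha * t%:R)%:M ((1 - alpha) *: inc_mx G1 R)
       ((1 - alpha) *: (inc_mx G1 R)^T)
       ((alpha * (2 * t%:R + #|G2|%:R) - 2 * (1 - alpha))%:M +
          (1 - alpha) *: ((inc_mx G1 R)^T *m inc_mx G1 R)))
    (col_mx 0 (const_mx (1 - alpha))) (row_mx 0 (const_mx (1 - alpha)))
    ((alpha * #|edge G1|%:R)%:M + A_mx G2 alpha)).
Proof.
(* [f] sends a block index to its place in the enumeration of the join; such a simultaneous
   reordering of rows and columns preserves the characteristic polynomial. *)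
move=> regG; pose f i := enum_rank (Qjoin_ord i).
have bf : bijective f.
  exact: bij_comp (enum_rank_bij _) Qjoin_ord_bij.
rewrite /char_poly -(det_mxsub_bij _ bf) -char_poly_mx_mxsub_bij //.
congr (\det (char_poly_mx _)); apply/matrixP => i j.
rewrite mxE A_mxE (inj_eq (bij_inj bf)) !enum_rankK /Qjoin_ord.
case: (split_ordP i) => [i'|k] ->; last first.
  rewrite degree_Qjoin_right.
  case: (split_ordP j) => [j'|l] ->.
    rewrite block_mxEdl eq_rlshift add0r.
    by case: (split_ordP j') => l ->; rewrite ?row_mxEl ?row_mxEr mxE ?mulr0 ?mulr1.
  rewrite block_mxEdr mxE A_mxE eq_rshift mxE.
  by rewrite natrD mulrDr mulrnDl addrA.
case: (split_ordP j) => [j'|l] ->; last first.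
  rewrite block_mxEur eq_lrshift add0r.
  by case: (split_ordP i') => l' ->; rewrite ?col_mxEu ?col_mxEd mxE ?mulr0 ?mulr1.
rewrite block_mxEul eq_lshift.
case: (split_ordP i') => k ->; case: (split_ordP j') => l ->.
- rewrite degree_Qjoin_vertex regG block_mxEul eq_lshift.
  by rewrite mulr0 addr0 mxE.
- rewrite block_mxEur eq_lrshift add0r.
  by rewrite !mxE.
- rewrite block_mxEdl eq_rlshift add0r.
  by rewrite !mxE.
rewrite (degree_Qjoin_edge _ regG) block_mxEdr eq_rshift.
rewrite inc_mx_tr_mul // !mxE natrD natrM /=; case: eqVneq => [->|_].
  by rewrite !mulr1n eqxx /=; ring.
by rewrite !mulr0n !add0r.
Qed.

End QJoinMatrix.

(** * Regular graphs *)

(** At an entry of the eigenvector of largest absolute value, the triangle inequality bounds |x| by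
    the column sum [t]. *)
Lemma eigenvalue_le_col_sum (R : realFieldType) n (M : 'M[R]_n) (t x : R) :
    (forall i j, 0 <= M i j) -> const_mx 1 *m M = t *: (const_mx 1 : 'rV_n) ->
  eigenvalue M x -> x <= t.
Proof.
move=> M0 hM /eigenvalueP[v hv v0].
have [i0 vi0] : exists i, v 0 i != 0.
  apply/existsP; apply: contraR v0 => /existsPn v0; apply/eqP/rowP => i.
  by rewrite mxE; apply/eqP; have := v0 i; rewrite negbK.
have [i _ maxi] := @Order.TotalTheory.arg_maxP _ _ _ i0 xpredT (fun i => `|v 0 i|) isT.
have vi : 0 < `|v 0 i| by apply: lt_le_trans (maxi i0 isT); rewrite normr_gt0.
apply: le_trans (ler_norm x) _; rewrite -(ler_pM2r vi) -normrM.
have -> : x * v 0 i = \sum_j v 0 j * M j i.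
  by have := congr1 (fun w : 'rV_n => w 0 i) hv; rewrite !mxE => <-.
have -> : t = \sum_j M j i.
  have := congr1 (fun w : 'rV_n => w 0 i) hM; rewrite !mxE mulr1 => <-.
  by apply: eq_bigr => j _; rewrite mxE mul1r.
apply: le_trans (ler_norm_sum _ _ _) _; rewrite mulr_suml.
apply: ler_sum => j _; rewrite normrM (ger0_norm (M0 _ _)) mulrC.
by rewrite ler_wpM2l //; exact: maxi.
Qed.

Section Regular.
Variables (G : sgraph) (t : nat).
Hypothesis regG : regular t G.

Lemma ones_adj_mx (R : comNzRingType) :
  const_mx 1 *m adj_mx R G = t%:R *: (const_mx 1 : 'rV_#|G|).
Proof.
apply/rowP => i; rewrite !mxE mulr1 -(regG (enum_val i)) degreeE -sum_enum_val.
by apply: eq_bigr => j _; rewrite !mxE mul1r adj_sym.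
Qed.

Lemma A_mx_regular (R : comNzRingType) (alpha : R) :
  A_mx G alpha = (alpha * t%:R)%:M + (1 - alpha) *: adj_mx R G.
Proof.
congr (_ + _); apply/matrixP => i j; rewrite !mxE regG.
by rewrite -mulrnAr.
Qed.

Variables (R : rcfType) (alpha : R).

Lemma char_poly_A_mx_eigenvalues (H : sgraph) :
  char_poly (A_mx H alpha) = \prod_(x <- eigenvalues (A_mx H alpha)) ('X - x%:P).
Proof.
have [|s hs] := @char_poly_sym_split _ _ (A_mx H alpha).
  apply/matrixP => i j; rewrite mxE !A_mxE adj_sym eq_sym.
  by case: eqVneq => [->|].
by rewrite {1}hs; apply: perm_big; rewrite perm_sym perm_eigenvalues.
Qed.

Lemma size_eigenvalues_A_mx (H : sgraph) :
  size (eigenvalues (A_mx H alpha)) = #|H|.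
Proof.
apply: succn_inj; rewrite -(size_char_poly (A_mx H alpha)).
by rewrite char_poly_A_mx_eigenvalues size_prod_XsubC.
Qed.

(** The ones vector has eigenvalue alpha t + (1 - alpha) t = t, and [alpha] in [0, 1] makes the
    entries nonnegative, so no eigenvalue exceeds [t]. Hence index 1 is the factor that the rank one
    term alters. *)
Lemma lambda1_regular :
  0 <= alpha <= 1 -> (0 < #|G|)%N -> lambda 1 (A_mx G alpha) = t%:R.
Proof.
move=> /andP[a0 a1] n0.
have mem_eig x : (x \in eigenvalues (A_mx G alpha)) = eigenvalue (A_mx G alpha) x.
  by rewrite eigenvalue_root_char [in RHS]char_poly_A_mx_eigenvalues root_prod_XsubC.
have ones_A : const_mx 1 *m A_mx G alpha = t%:R *: (const_mx 1 : 'rV_#|G|).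
  rewrite A_mx_regular mulmxDr mul_mx_scalar -scalemxAr ones_adj_mx scalerA.
  by rewrite -scalerDl; congr (_ *: _); ring.
apply: lambda1E => [|x]; rewrite mem_eig.
  apply/eigenvalueP; exists (const_mx 1) => //.
  apply/eqP => /rowP/(_ (Ordinal n0)); rewrite !mxE; exact/eqP/oner_neq0.
apply: eigenvalue_le_col_sum => // i j; rewrite A_mxE addr_ge0 //.
  by rewrite mulrn_wge0 // mulr_ge0.
by rewrite mulr_ge0 // subr_ge0.
Qed.

End Regular.

(** * Evaluation at a generic point and the identity of rational functions *)

Lemma frac_char_poly_comp (R : fieldType) n (M : 'M[R]_n) (q : {poly R}) :
  (char_poly M \Po q)%:F = \det (q%:F%:M - map_mx (fun x : R => (x%:P)%:F) M).
Proof.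
rewrite char_poly_comp -det_map_mx map_mxB map_scalar_mx; congr (\det (_ - _)).
by rewrite -map_mx_comp.
Qed.

(* [lin_neq0] and [quad_neq0] are all that is needed of [nu] being an
   indeterminate over [R]; they are satisfied by ['X] in the rational functions. *)
Section GenericPoint.
Variables (R : rcfType) (K : fieldType) (phi : {rmorphism R -> K}) (nu : K).
Variables (alpha : R) (G1 G2 : sgraph) (t1 : nat).
Hypotheses (alpha01 : 0 <= alpha <= 1) (regG1 : regular t1 G1).
Hypothesis G1_gt0 : (0 < #|G1|)%N.
Hypothesis lin_neq0 : forall x, nu + phi x != 0.
Hypothesis quad_neq0 : forall x y, nu ^+ 2 + phi x * nu + phi y != 0.

Let m := #|edge G1|.
Let N : 'M[K]_#|G2| := (nu - phi (alpha * m%:R))%:M - map_mx phi (A_mx G2 alpha).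

(** This is [det_join_block] for the incidence matrix, with det(g - h B B^T) split over the
    eigenvalues of [A_mx G1 alpha]. The first exponent is an integer because it can be negative, as
    for [t1 = 1]. *)
Lemma det_Qjoin_at :
    N \in unitmx ->
  \det (nu%:M - map_mx phi (block_mx
    (block_mx (alpha * t1%:R)%:M ((1 - alpha) *: inc_mx G1 R)
       ((1 - alpha) *: (inc_mx G1 R)^T)
       ((alpha * (2 * t1%:R + #|G2|%:R) - 2 * (1 - alpha))%:M +
          (1 - alpha) *: ((inc_mx G1 R)^T *m inc_mx G1 R)))
    (col_mx 0 (const_mx (1 - alpha))) (row_mx 0 (const_mx (1 - alpha)))
    ((alpha * m%:R)%:M + A_mx G2 alpha))) =
  (nu + phi (2 - alpha * (2 * t1%:R + #|G2|%:R + 2))) ^ (m%:Z - #|G1|%:Z)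
  * \det N
  * (\prod_(2 <= i < #|G1|.+1)
       (nu ^+ 2
        - phi (alpha * (t1%:R + #|G2|%:R + 2) + t1%:R - 2
               + lambda i (A_mx G1 alpha)) * nu
        + phi (alpha ^+ 2 * t1%:R * #|G2|%:R
               + (alpha * (t1%:R + 1) - 1)
                 * (t1%:R + lambda i (A_mx G1 alpha)))))
  * (((nu - phi (alpha * t1%:R))
        * (nu - phi (2 * alpha * t1%:R) - phi (alpha * #|G2|%:R))
      - phi ((1 - alpha) * (2 * t1%:R - 2))
        * (nu - phi (alpha * t1%:R) + phi (1 - alpha))
      - phi (2 * (1 - alpha) ^+ 2))
     - phi (m%:R * (1 - alpha) ^+ 2) * (nu - phi (alpha * t1%:R))
       * ((const_mx 1 : 'cV_#|G2|)^T *m invmx N *m (const_mx 1 : 'cV_#|G2|)) 0 0).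
Proof.
move=> uN; pose t : K := t1%:R; pose n2 : K := #|G2|%:R.
pose al : K := phi alpha; pose b : K := 1 - al.
pose a : K := nu - al * t; pose c : K := nu + 2 - al * (2 * t + n2 + 2).
pose s := eigenvalues (A_mx G1 alpha).
have phiN k : phi k%:R = k%:R by exact: rmorph_nat.
pose phiE := (rmorphB phi, rmorphN phi, rmorphM phi, rmorphD phi, rmorphXn phi,
  rmorph1 phi, phiN).
have aE : a = nu + phi (- (alpha * t1%:R)) by rewrite !phiE.
have cE : c = nu + phi (2 - alpha * (2 * t1%:R + #|G2|%:R + 2)).
  by rewrite !phiE /c -/al -/t -/n2; ring.
have a0 : a != 0 by rewrite aE.
have c0 : c != 0 by rewrite cE.
have ab0 : a + b != 0.
  have -> : a + b = nu + phi (1 - alpha - alpha * t1%:R); last by [].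
  by rewrite !phiE /a /b -/al -/t; ring.
(* [q] is the factor belonging to lambda_1 = t1. Expanded in [nu] it is a monic quadratic with
   coefficients from [R], hence nonzero. *)
pose q : K := a * c - b * (a + b) * (2 * t).
have q0 : q != 0.
  have -> : q = nu ^+ 2 + phi (2 - alpha * (2 * t1%:R + #|G2|%:R + 2)
       - alpha * t1%:R - 2 * (1 - alpha) * t1%:R) * nu +
     phi (- (alpha * t1%:R) * (2 - alpha * (2 * t1%:R + #|G2|%:R + 2)) -
           2 * (1 - alpha) * (1 - alpha - alpha * t1%:R) * t1%:R); last by [].
  by rewrite !phiE /q /a /c /b -/al -/t -/n2; ring.
have two0 : 2 != 0 :> K by rewrite -phiN fmorph_eq0 pnatr_eq0.
have hB : map_mx phi (inc_mx G1 R) = inc_mx G1 K.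
  by apply/matrixP => i j; rewrite !mxE phiN.
have hA : map_mx phi (adj_mx R G1) = adj_mx K G1.
  by apply/matrixP => i j; rewrite !mxE phiN.
have hb : phi (1 - alpha) = b by rewrite !phiE.
have hc : nu - phi (alpha * (2 * t1%:R + #|G2|%:R) - 2 * (1 - alpha)) = c.
  by rewrite !phiE /c -/al -/t -/n2; ring.
have scalB n x y : (x - y)%:M = x%:M - y%:M :> 'M[K]_n.
  by apply/matrixP => i j; rewrite !mxE mulrnBl.
set M := nu%:M - _.
have {M}-> : M = block_mx
     (block_mx a%:M (- b *: inc_mx G1 K) (- b *: (inc_mx G1 K)^T)
        (c%:M - b *: ((inc_mx G1 K)^T *m inc_mx G1 K)))
     (col_mx 0 (const_mx (- b))) (row_mx 0 (const_mx (- b))) N.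
  rewrite /M /N; move: (A_mx G2 alpha) => A2.
  rewrite !map_block_mx map_col_mx map_row_mx !map_mxD !map_mxZ.
  rewrite map_mxM -!map_trmx hB !map_scalar_mx !map_mx0 !map_const_mx.
  rewrite !scalar_mx_block !opp_block_mx !add_block_mx !sub0r opp_col_mx opp_row_mx.
  rewrite !oppr0 !hb -!scaleNr; congr (block_mx (block_mx _ _ _ _) _ _ _).
  - by rewrite aE rmorphN scalB.
  - by rewrite -hc scalB opprD addrA scaleNr.
  - by congr col_mx; apply/matrixP => i j; rewrite !mxE.
  - by congr row_mx; apply/matrixP => i j; rewrite !mxE.
  by rewrite scalB opprD addrA.
have := det_join_block two0 a0 c0 q0 uN (ones_inc_mx G1 K) (inc_mx_ones K regG1).
rewrite -/q (inc_mx_mul_tr K regG1).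
(* The factor g - h (t + mu) for an eigenvalue mu of A(G1), in terms of x = alpha t + (1 - alpha)
   mu. As h = b (a + b), only b mu = x - alpha t enters; nothing is divided by 1 - alpha, so alpha =
   1 is covered. *)
pose F x := a * c - b * (a + b) * t - (a + b) * (phi x - al * t).
have -> : \det ((a * c)%:M - (b * (a + b)) *: (t%:M + adj_mx K G1)) =
    q * \prod_(2 <= i < #|G1|.+1) F (lambda i (A_mx G1 alpha)).
  have -> : (a * c)%:M - (b * (a + b)) *: (t%:M + adj_mx K G1) =
      (a * c - b * (a + b) * t + (a + b) * (al * t))%:M -
      (a + b) *: map_mx phi (A_mx G1 alpha).
    rewrite (A_mx_regular regG1) map_mxD map_mxZ map_scalar_mx hA hb (rmorphM phi) phiN.
    apply/matrixP => i j; rewrite !mxE -/al -/t.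
    by case: (i == j); rewrite ?mulr1n ?mulr0n; ring.
  rewrite (@det_scalar_sub _ _ _ (map phi s)) //; last first.
    rewrite -map_char_poly (char_poly_A_mx_eigenvalues alpha G1) rmorph_prod big_map.
    by apply: eq_bigr => x _; rewrite rmorphB /= map_polyX map_polyC.
  rewrite big_map (eq_bigr F) => [|x _]; last by rewrite /F; ring.
  (* The factor of index 1 is split off; at lambda_1 = t1 it becomes [q]. *)
  rewrite prod_lambda size_eigenvalues_A_mx big_ltn // (lambda1_regular regG1) //.
  by congr (_ * _); rewrite /F /q /b phiN -/t; ring.
(* Both sides are multiplied by the nonzero c^n q: the power turns c^(m - n) into c^m, and [q]
   matches the factor split off at lambda_1. *)
move=> e; apply: (mulIf (mulf_neq0 (expf_neq0 #|G1| c0) q0)); rewrite {}e -cE.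
have trE : (const_mx 1 : 'rV[K]_#|G2|)^T = const_mx 1 by rewrite trmx_const.
rewrite trE trmx_const; set G := (_ *m _ *m _) 0 0.
set Q := (\prod_(2 <= i < _) _ in RHS); set L := (X in _ = _ * X * _).
have -> : L = q - m%:R * b ^+ 2 * a * G.
  by rewrite /L !phiE /q /c /a /b -/al -/t -/n2; ring.
have -> : \prod_(2 <= i < #|G1|.+1) F (lambda i (A_mx G1 alpha)) = Q.
  apply: eq_bigr => i _.
  by rewrite !phiE /F /c /a /b -/al -/t -/n2; ring.
have <- : c ^ (m%:Z - #|G1|%:Z) * c ^+ #|G1| = c ^+ m.
  by rewrite -[c ^+ #|G1|]/(c ^ #|G1|%:Z) -expfzDr // subrK.
by move: (c ^+ #|G1|) (c ^ _) => u v; ring.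
Qed.

End GenericPoint.

Theorem theorem4p1 (R : rcfType) (alpha : R) (G1 G2 : sgraph)
    (t1 n1 m1 n2 : nat)
    (halpha : 0 <= alpha <= 1)
    (hreg : regular t1 G1)
    (hn1 : #|G1| = n1) (n1_gt0 : (0 < n1)%N)
    (hm1 : #|edges G1| = m1)
    (hn2 : #|G2| = n2) :
  (char_poly (A_mx (Qjoin G1 G2) alpha))%:F =
    ('X + (2 - alpha * (2 * t1%:R + n2%:R + 2))%:P)%:F ^ (m1%:Z - n1%:Z)
    * (char_poly (A_mx G2 alpha) \Po ('X - (alpha * m1%:R)%:P))%:F
    * (\prod_(2 <= i < n1.+1)
         ('X^2
          - (alpha * (t1%:R + n2%:R + 2) + t1%:R - 2
             + lambda i (A_mx G1 alpha))%:P * 'X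
          + (alpha ^+ 2 * t1%:R * n2%:R
             + (alpha * (t1%:R + 1) - 1)
               * (t1%:R + lambda i (A_mx G1 alpha)))%:P))%:F
    * ((('X - (alpha * t1%:R)%:P)
          * ('X - (2 * alpha * t1%:R)%:P - (alpha * n2%:R)%:P)
        - ((1 - alpha) * (2 * t1%:R - 2))%:P
          * ('X - (alpha * t1%:R)%:P + (1 - alpha)%:P)
        - (2 * (1 - alpha) ^+ 2)%:P)%:F
       - ((m1%:R * (1 - alpha) ^+ 2)%:P * ('X - (alpha * t1%:R)%:P))%:F
         * coronal (A_mx G2 alpha) ('X - (alpha * m1%:R)%:P)%:F)
  :> ratfun R.
Proof.
subst n1 m1 n2.
have cardE : #|edge G1| = #|edges G1| by rewrite card_sig; apply: eq_card.
(* The generic point is the indeterminate ['X%:F], with [R] embedded as constants. *)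
pose phi : {rmorphism R -> ratfun R} := @tofrac {poly R} \o polyC.
have lin_neq0 x : 'X%:F + phi x != 0.
  by rewrite -tofracD tofrac_eq0 -size_poly_gt0 size_XaddC.
have quad_neq0 x y : 'X%:F ^+ 2 + phi x * 'X%:F + phi y != 0.
  rewrite -tofracXn -tofracM -!tofracD tofrac_eq0.
  apply/eqP => /(congr1 (coefp 2)); rewrite /= !coefE mulr0 !addr0 => /eqP.
  by rewrite eqxx oner_eq0.
have detN : (char_poly (A_mx G2 alpha) \Po ('X - (alpha * #|edge G1|%:R)%:P))%:F =
    \det (('X%:F - phi (alpha * #|edge G1|%:R))%:M - map_mx phi (A_mx G2 alpha)).
  by rewrite frac_char_poly_comp tofracB.
(* A nonzero polynomial stays nonzero after composition with one of degree 1, so the inverse inside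
   [coronal] is a true one. *)
have uN : ('X%:F - phi (alpha * #|edge G1|%:R))%:M - map_mx phi (A_mx G2 alpha)
    \in unitmx.
  rewrite unitmxE unitfE -detN tofrac_eq0 comp_poly2_eq0 ?size_XsubC //.
  exact/monic_neq0/char_poly_monic.
(* Composing with ['X] changes nothing but lets [frac_char_poly_comp] turn the left side into a
   determinant over the rational functions. *)
rewrite -cardE (char_poly_A_Qjoin _ _ hreg) -[char_poly _]comp_polyXr frac_char_poly_comp.
rewrite (det_Qjoin_at halpha hreg n1_gt0 lin_neq0 quad_neq0 uN) detN.
have linE x : ('X + x%:P)%:F = 'X%:F + phi x by rewrite tofracD.
have quadE x y :
    ('X^2 - x%:P * 'X + y%:P)%:F = 'X%:F ^+ 2 - phi x * 'X%:F + phi y.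
  by rewrite tofracD tofracB tofracXn tofracM.
have lastE x1 x2 x3 x4 x5 x6 :
    (('X - x1%:P) * ('X - x2%:P - x3%:P) - x4%:P * ('X - x1%:P + x5%:P) - x6%:P)%:F
    = ('X%:F - phi x1) * ('X%:F - phi x2 - phi x3)
      - phi x4 * ('X%:F - phi x1 + phi x5) - phi x6.
  by rewrite !tofracB !tofracM !tofracB tofracD tofracB.
have mulE x y : (x%:P * ('X - y%:P))%:F = phi x * ('X%:F - phi y).
  by rewrite tofracM tofracB.
have subE y : ('X - y%:P)%:F = 'X%:F - phi y by rewrite tofracB.
have prodE k (F F' : nat -> R) :
    (\prod_(2 <= i < k) ('X^2 - (F i)%:P * 'X + (F' i)%:P))%:F =
    \prod_(2 <= i < k) ('X%:F ^+ 2 - phi (F i) * 'X%:F + phi (F' i)).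
  by rewrite rmorph_prod; apply: eq_bigr => i _; rewrite [LHS]quadE.
by rewrite linE lastE mulE prodE /coronal subE.
Qed.
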